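(* Let $\mathcal{G}=([n],\mathcal{E},\mathcal{A})$ be a weight balanced directed weighted graph with loopy Laplacian $\mathcal{Q}$, and let $\alpha\subsetneq[n]$ with $|\alpha|\ge2$ be such that $\mathcal{Q}[\alpha^c,\alpha^c]$ is nonsingular. Suppose $\mathcal{A}_{ii}=0$ for all $i\in\alpha^c$. Then the Kron-reduced graph $\mathcal{G}_{\mathrm{red}}$, i.e. the graph on node set $\alpha$ whose loopy Laplacian is $\mathcal{Q}_{\mathrm{red}}=\mathcal{Q}[\alpha,\alpha]-\mathcal{Q}[\alpha,\alpha^c]\mathcal{Q}[\alpha^c,\alpha^c]^{-1}\mathcal{Q}[\alpha^c,\alpha]$, is also weight balanced.
   Context: A directed weighted graph $\mathcal{G}=([n],\mathcal{E},\mathcal{A})$ has node set $[n]$ and weighted adjacency matrix $\mathcal{A}\in\mathbb{R}^{n\times n}$ with nonnegative entries; $\mathcal{A}_{ii}>0$ means node $i$ has a self-loop. The degree matrix is $\mathcal{D}=\mathrm{diag}(\sum_j\mathcal{A}_{ij})_{i}$, the loop-less Laplacian is $\mathcal{L}=\mathcal{D}-\mathcal{A}$, and the loopy Laplacian is $\mathcal{Q}=\mathcal{L}+\mathrm{diag}(\mathcal{A}_{11},\dots,\mathcal{A}_{nn})$. Any real square matrix $Q$ with nonpositive off-diagonal entries and nonnegative row sums is the loopy Laplacian of exactly one graph, namely the one with $\mathcal{A}_{ii}=\sum_j Q_{ij}$ and $\mathcal{A}_{ij}=-Q_{ij}$ for $i\neq j$. A graph is weight balanced if $\sum_j\mathcal{A}_{ij}=\sum_j\mathcal{A}_{ji}$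 for every node $i$. $M[\beta,\gamma]$ denotes the submatrix with rows in $\beta$ and columns in $\gamma$, and $\alpha^c=[n]\setminus\alpha$. *)

(* Defs.v *)
From mathcomp Require Import all_boot all_order all_algebra.

Set Implicit Arguments.
Unset Strict Implicit.
Unset Printing Implicit Defensive.

Import GRing.Theory Num.Theory.

Local Open Scope ring_scope.

(* The edge set is not stored: (i, j) is an edge iff [0 < adj G i j], and
   [0 < adj G i i] is a self-loop.  Nonnegativity is boolean so that a graph is
   determined by its adjacency matrix. *)
Record wdigraph (R : realFieldType) (n : nat) := WDigraph {
  adj : 'M[R]_n;
  adj_ge0 : [forall i, forall j, 0 <= adj i j]
}.

Definition degree_mx (R : realFieldType) (n : nat) (G : wdigraph R n) : 'M[R]_n :=
  diag_mx (\row_i \sum_j adj G i j).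

Definition loopless_laplacian (R : realFieldType) (n : nat) (G : wdigraph R n) :
    'M[R]_n :=
  degree_mx G - adj G.

Definition loopy_laplacian (R : realFieldType) (n : nat) (G : wdigraph R n) :
    'M[R]_n :=
  loopless_laplacian G + diag_mx (\row_i adj G i i).

Definition weight_balanced (R : realFieldType) (n : nat) (G : wdigraph R n) : Prop :=
  forall i : 'I_n, \sum_j adj G i j = \sum_j adj G j i.

(* M[b, c]; rows and columns are listed in increasing order of their index. *)
Definition set_submx (R : realFieldType) (n : nat) (M : 'M[R]_n) (b c : {set 'I_n}) :
    'M[R]_(#|b|, #|c|) :=
  mxsub (@enum_val _ (mem b)) (@enum_val _ (mem c)) M.

(* [invmx] is the true inverse only when [set_submx Q (~: a) (~: a)] is in
   [unitmx]. *)
Definition kron_mx (R : realFieldType) (n : nat) (Q : 'M[R]_n) (a : {set 'I_n}) :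
    'M[R]_#|a| :=
  set_submx Q a a
  - set_submx Q a (~: a) *m invmx (set_submx Q (~: a) (~: a)) *m set_submx Q (~: a) a.

(* H is a graph on the node set a, whose k-th smallest element is node k of H. *)
Definition is_kron_reduction (R : realFieldType) (n : nat) (G : wdigraph R n)
    (a : {set 'I_n}) (H : wdigraph R #|a|) : Prop :=
  loopy_laplacian H = kron_mx (loopy_laplacian G) a.

(* Main.v *)
Require Import Defs.
From mathcomp Require Import all_boot all_order all_algebra.

Set Implicit Arguments.
Unset Strict Implicit.
Unset Printing Implicit Defensive.

Import Order.TTheory GRing.Theory Num.Theory.

Local Open Scope ring_scope.

(** A graph is weight balanced iff each row sum of its loopy Laplacian Q equals
    the corresponding column sum.  Since the eliminated nodes carry no loops,
    the rows of Q indexed by them sum to zero, i.e. Q[c,a] 1 = - Q[c,c] 1, and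
    hence the row sums of the Schur complement are those of Q.  By balance the
    same applies to the transpose of Q, so row and column sums still agree.
    The Schur complement is a loopy Laplacian because Q[c,c], a nonsingular
    matrix with nonpositive off-diagonal entries and nonnegative row sums, has
    a nonnegative inverse. *)

Lemma mulmx_const1 (R : realFieldType) (m p : nat) (M : 'M[R]_(m, p)) i :
  (M *m const_mx 1 : 'cV_m) i 0 = \sum_j M i j.
Proof. by rewrite mxE; apply: eq_bigr => j _; rewrite mxE mulr1. Qed.

Section InverseNonnegative.

Variables (R : realFieldType) (n : nat) (M : 'M[R]_n).
Hypothesis offdiag_le0 : forall i j, i != j -> M i j <= 0.

(** With t the minimal ratio, x - t y is nonnegative and vanishes at i, so row i of [M] meets it
    only through nonpositive off-diagonal entries. *)
Lemma mulmx_le_at_min_ratio (x y : 'cV[R]_n) (i : 'I_n) :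
    (forall j, 0 < y j 0) ->
    (forall j, x i 0 / y i 0 <= x j 0 / y j 0) ->
  (M *m x) i 0 <= x i 0 / y i 0 * (M *m y) i 0.
Proof.
move=> y_gt0 imin; rewrite !mxE mulr_sumr; apply: ler_sum => j _.
rewrite mulrCA; have [<-|nij] := eqVneq i j.
  by rewrite divfK // gt_eqF.
apply: ler_wnM2l; first exact: offdiag_le0.
by rewrite -ler_pdivlMr.
Qed.

Hypothesis rowsum_ge0 : forall i, 0 <= \sum_j M i j.
Hypothesis M_unit : M \in unitmx.

(** At a minimal entry y_k of y, comparison with the constant vector 1 bounds (M y)_k = 1 by y_k
    times a nonnegative row sum, which forces y_k > 0. *)
Lemma invmx_const1_gt0 (i : 'I_n) :
  0 < (invmx M *m const_mx 1 : 'cV_n) i 0.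
Proof.
set y : 'cV_n := invmx M *m const_mx 1.
have My : M *m y = const_mx 1 by rewrite mulKVmx.
have [k _ kmin] := @arg_minP _ R _ i predT (fun j => y j 0) isT.
apply: lt_le_trans (kmin i isT).
have le1 : 1 <= y k 0 * \sum_j M k j.
  have := @mulmx_le_at_min_ratio y (const_mx 1) k.
  rewrite My mulmx_const1 ![const_mx _ _ _]mxE divr1.
  apply=> j; rewrite [const_mx _ _ _]mxE ?divr1 //.
  exact: kmin.
rewrite ltNge; apply/negP => yk_le0.
have := le_trans le1 (mulr_le0_ge0 yk_le0 (rowsum_ge0 k)).
by rewrite ler10.
Qed.

(* Comparing x with the positive vector y = M^-1 1, rather than with 1, makes the
   minimum principle strict, as M y > 0 while row sums of M may vanish. *)
Lemma mulmx_ge0_inv (x : 'cV[R]_n) :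
  (forall i, 0 <= (M *m x) i 0) -> forall i, 0 <= x i 0.
Proof.
move=> Mx_ge0 i; set y : 'cV_n := invmx M *m const_mx 1.
have y_gt0 j : 0 < y j 0 by apply: invmx_const1_gt0.
have [k _ kmin] := @arg_minP _ R _ i predT (fun j => x j 0 / y j 0) isT.
have := @mulmx_le_at_min_ratio x y k y_gt0 (fun j => kmin j isT).
rewrite mulKVmx // [const_mx _ _ _]mxE mulr1 => /(le_trans (Mx_ge0 k)) xk_ge0.
have := le_trans xk_ge0 (kmin i isT).
by rewrite ler_pdivlMr // mul0r.
Qed.

Lemma invmx_ge0 (i j : 'I_n) : 0 <= invmx M i j.
Proof.
(* [M] sends column j of its inverse to a nonnegative unit vector. *)
have -> : invmx M i j = col j (invmx M) i 0 by rewrite mxE.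
apply: mulmx_ge0_inv => k.
by rewrite colE mulKVmx // !mxE ler0n.
Qed.

End InverseNonnegative.

Section LoopyLaplacian.

Variables (R : realFieldType) (n : nat).
Implicit Types (G H : wdigraph R n) (Q : 'M[R]_n).

Lemma loopy_laplacianE G i j :
  loopy_laplacian G i j =
    (\sum_k adj G i k) *+ (i == j) - adj G i j + adj G i i *+ (i == j).
Proof. by rewrite !mxE. Qed.

Lemma loopy_laplacian_offdiag G i j :
  i != j -> loopy_laplacian G i j = - adj G i j.
Proof.
by move=> /negPf nij; rewrite loopy_laplacianE nij !mulr0n sub0r addr0.
Qed.

Lemma sum_delta (F : 'I_n -> R) (i : 'I_n) : \sum_k F k *+ (k == i) = F i.
Proof.
rewrite (bigD1 i) //= eqxx big1 ?addr0 // => k /negPf ->.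
by rewrite mulr0n.
Qed.

Lemma loopy_laplacian_rowsum G i : \sum_j loopy_laplacian G i j = adj G i i.
Proof.
under eq_bigr do rewrite loopy_laplacianE eq_sym.
by rewrite !big_split /= sumrN !sum_delta subrr add0r.
Qed.

Lemma loopy_laplacian_colsum G i :
  \sum_j loopy_laplacian G j i =
    \sum_j adj G i j - \sum_j adj G j i + adj G i i.
Proof.
under eq_bigr do rewrite loopy_laplacianE.
by rewrite !big_split /= sumrN !sum_delta.
Qed.

(** Row sum i is the loop weight at i; column sum i differs from it by out-degree minus
    in-degree. *)
Lemma weight_balancedP G :
  weight_balanced G <->
  forall i, \sum_j loopy_laplacian G i j = \sum_j loopy_laplacian G j i.
Proof.
split=> bal i.
  by rewrite loopy_laplacian_rowsum loopy_laplacian_colsum bal subrr add0r.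
have /eqP := bal i.
rewrite loopy_laplacian_rowsum loopy_laplacian_colsum -subr_eq subrr.
by rewrite eq_sym subr_eq0 => /eqP.
Qed.

Lemma adj_inj G H : adj G = adj H -> G = H.
Proof.
case: G H => [A A_ge0] [B B_ge0] /= eqAB; subst B.
by rewrite (bool_irrelevance A_ge0 B_ge0).
Qed.

Lemma loopy_laplacian_inj G H : loopy_laplacian G = loopy_laplacian H -> G = H.
Proof.
move=> eqQ; apply/adj_inj/matrixP => i j; have [<-|nij] := eqVneq i j.
  by rewrite -!loopy_laplacian_rowsum eqQ.
by apply: oppr_inj; rewrite -!loopy_laplacian_offdiag // eqQ.
Qed.

Lemma loopy_laplacian_surj Q :
    (forall i j, i != j -> Q i j <= 0) -> (forall i, 0 <= \sum_j Q i j) ->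
  exists G, loopy_laplacian G = Q.
Proof.
move=> Q_le0 Q_ge0.
pose A := \matrix_(i, j) if i == j then \sum_k Q i k else - Q i j.
have A_ge0 : [forall i, forall j, 0 <= A i j].
  apply/forallP=> i; apply/forallP=> j; rewrite mxE.
  by case: eqVneq => [_|nij] //; rewrite oppr_ge0 Q_le0.
exists (WDigraph A_ge0); apply/matrixP => i j.
have [<-|nij] := eqVneq i j; last first.
  by rewrite loopy_laplacian_offdiag //= mxE (negPf nij) opprK.
(* On the diagonal the loop terms cancel, leaving row sum i of [A]; there the entries [- Q i k]
   cancel all of [\sum_k Q i k] except [Q i i]. *)
rewrite loopy_laplacianE eqxx /= !mulr1n subrK (bigD1 i) //= mxE eqxx.
rewrite (bigD1 i) //= -addrA -big_split /= big1 ?addr0 // => k nki.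
by rewrite mxE eq_sym (negPf nki) subrr.
Qed.

End LoopyLaplacian.

Section KronReduction.

Variables (R : realFieldType) (n : nat).
Implicit Types (Q : 'M[R]_n) (a b c : {set 'I_n}).

Lemma tr_set_submx Q b c : (set_submx Q b c)^T = set_submx Q^T c b.
Proof. by apply/matrixP => i j; rewrite !mxE. Qed.

Lemma tr_kron_mx Q a : (kron_mx Q a)^T = kron_mx Q^T a.
Proof.
rewrite /kron_mx linearB /= !trmx_mul trmx_inv !tr_set_submx.
by rewrite mulmxA.
Qed.

Lemma set_submx_rowsum Q a b (i : 'I_#|b|) :
  \sum_j set_submx Q b a i j + \sum_j set_submx Q b (~: a) i j =
    \sum_j Q (enum_val i) j.
Proof.
rewrite [RHS](bigID (mem a)) /=; congr (_ + _).
  by rewrite [RHS]big_enum_val; apply: eq_bigr => j _; rewrite mxE.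
rewrite [RHS](eq_bigl [in ~: a]) => [|j]; last by rewrite /= in_setC.
by rewrite [RHS]big_enum_val; apply: eq_bigr => j _; rewrite mxE.
Qed.

Lemma kron_mx_rowsum Q a (i : 'I_#|a|) :
    set_submx Q (~: a) (~: a) \in unitmx ->
    (forall k, k \in ~: a -> \sum_j Q k j = 0) ->
  \sum_j kron_mx Q a i j = \sum_j Q (enum_val i) j.
Proof.
move=> Qcc_unit Qc0.
have Qca1 : set_submx Q (~: a) a *m const_mx 1 =
    - (set_submx Q (~: a) (~: a) *m const_mx 1) :> 'cV_#|~: a|.
  apply/eqP; rewrite -subr_eq0 opprK; apply/eqP/colP => k.
  rewrite mxE !mulmx_const1 set_submx_rowsum Qc0 ?enum_valP //.
  by rewrite mxE.
(* After substituting [Qca1], the inverse cancels and the correction term becomes Q[a,c] 1,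
   completing the row sums of Q[a,a]. *)
rewrite -mulmx_const1 mulmxBl -!mulmxA Qca1 !mulmxN mulKmx // opprK.
by rewrite mxE !mulmx_const1 set_submx_rowsum.
Qed.

(** Kron reduction commutes with transposition, so this is the row statement for [Q^T]. *)
Lemma kron_mx_colsum Q a (i : 'I_#|a|) :
    set_submx Q (~: a) (~: a) \in unitmx ->
    (forall k, k \in ~: a -> \sum_j Q j k = 0) ->
  \sum_j kron_mx Q a j i = \sum_j Q j (enum_val i).
Proof.
move=> Qcc_unit Qc0.
transitivity (\sum_j kron_mx Q^T a i j).
  by apply: eq_bigr => j _; rewrite -tr_kron_mx [RHS]mxE.
rewrite kron_mx_rowsum.
- by apply: eq_bigr => j _; rewrite mxE.
- by rewrite -tr_set_submx unitmx_tr.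
by move=> k kc; rewrite -[RHS](Qc0 k kc); apply: eq_bigr => j _; rewrite mxE.
Qed.

(** The blocks Q[a,c] and Q[c,a] lie off the diagonal, hence are nonpositive; with a nonnegative
    inverse between them, the subtracted product is nonnegative. *)
Lemma kron_mx_offdiag_le0 Q a (i j : 'I_#|a|) :
    (forall k l, k != l -> Q k l <= 0) -> (forall k, 0 <= \sum_l Q k l) ->
    set_submx Q (~: a) (~: a) \in unitmx ->
  i != j -> kron_mx Q a i j <= 0.
Proof.
move=> Q_le0 Q_ge0 Qcc_unit nij.
have neq_ac (k : 'I_#|a|) (l : 'I_#|~: a|) : enum_val k != enum_val l.
  apply/eqP=> eq_kl; have := enum_valP l.
  by rewrite -eq_kl inE enum_valP.
have inv_ge0 k l : 0 <= invmx (set_submx Q (~: a) (~: a)) k l.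
  apply: invmx_ge0 => // {k l} [k l nkl|k].
    by rewrite mxE Q_le0 // (inj_eq enum_val_inj).
  (* Dropping the nonpositive entries of Q[c,a] can only increase a row sum. *)
  apply: le_trans (Q_ge0 (enum_val k)) _.
  rewrite -(set_submx_rowsum Q a) gerDr sumr_le0 // => l _.
  by rewrite mxE Q_le0 // eq_sym.
rewrite !mxE subr_le0; apply: (@le_trans _ _ 0).
  by rewrite Q_le0 // (inj_eq enum_val_inj).
apply: sumr_ge0 => l _; rewrite mxE mulr_suml sumr_ge0 // => k _.
rewrite !mxE mulr_le0 //; last by rewrite Q_le0 // eq_sym.
by rewrite mulr_le0_ge0 // Q_le0.
Qed.

End KronReduction.

Theorem theorem3p11 (R : realFieldType) (n : nat) (G : wdigraph R n)
    (alpha : {set 'I_n})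
    (Gbal : weight_balanced G)
    (alpha_proper : alpha \proper [set: 'I_n])
    (alpha_ge2 : (2 <= #|alpha|)%N)
    (Qcc_nonsing : set_submx (loopy_laplacian G) (~: alpha) (~: alpha) \in unitmx)
    (no_loops : forall i : 'I_n, i \in ~: alpha -> adj G i i = 0) :
  (exists! Gred : wdigraph R #|alpha|, is_kron_reduction G Gred) /\
  (forall Gred : wdigraph R #|alpha|,
      is_kron_reduction G Gred -> weight_balanced Gred).
Proof.
set Q := loopy_laplacian G in Qcc_nonsing *.
have Q_le0 i j : i != j -> Q i j <= 0.
  move=> nij; rewrite loopy_laplacian_offdiag // oppr_le0.
  by have /forallP/(_ i)/forallP/(_ j) := adj_ge0 G.
have Q_ge0 i : 0 <= \sum_j Q i j.
  rewrite loopy_laplacian_rowsum.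
  by have /forallP/(_ i)/forallP/(_ i) := adj_ge0 G.
have Qbal : forall i, \sum_j Q i j = \sum_j Q j i by apply/weight_balancedP.
have Qc0 i : i \in ~: alpha -> \sum_j Q i j = 0.
  by rewrite loopy_laplacian_rowsum; apply: no_loops.
split.
  have [||Gred QredE] := @loopy_laplacian_surj _ _ (kron_mx Q alpha).
  - by move=> i j; apply: kron_mx_offdiag_le0.
  - by move=> i; rewrite kron_mx_rowsum.
  exists Gred; split=> // H HE.
  by apply: loopy_laplacian_inj; rewrite QredE HE.
move=> Gred QredE; apply/weight_balancedP => i.
rewrite QredE kron_mx_rowsum // kron_mx_colsum // => k kc.
(* Balance turns the zero row sums at eliminated nodes into zero column sums. *)
by rewrite -Qbal Qc0.
Qed.
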